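(* Let $m\ge2$, $n\ge1$, and assume a finite approximation set $Y=\{\mathbf y^{(1)},\dots,\mathbf y^{(n)}\}\in(\mathbb R^m)^n$. Define $\mathbf y^{(\alpha)}_{-k}=\operatorname{proj}_k(\mathbf y^{(\alpha)})$ for $\alpha\in\{1,\dots,n\}$, and the index set $I(Y,i,k)=\{\alpha\in\{1,\dots,n\}: y^{(\alpha)}_k<y^{(i)}_k\}$, which selects the points in $Y$ whose $k$-th component is strictly better (smaller) than $y^{(i)}_k$. Then for all $i\in\{1,\dots,n\}$ and $k\in\{1,\dots,m\}$ the partial derivative of $\mathcal H$ with respect to $y^{(i)}_k$ admits the expression $$\frac{\partial\mathcal H(\mathbf Y)}{\partial y^{(i)}_k}=-\operatorname{HVC}\Big(\mathbf y^{(i)}_{-k},\ \{\mathbf y^{(\alpha)}_{-k}:\alpha\in I(Y,i,k)\}\Big),$$ where $\mathbf Y=\operatorname{concat}(Y)$ and $\operatorname{HVC}(\mathbf y,P)$ is the hypervolume contribution of the point $\mathbf y$ to a finite point set $P$, i.e. $$\operatorname{HVC}(\mathbf y,P)=\operatorname{HV}(P\cup\{\mathbf y\})-\operatorname{HV}(P)=\lambda_{m-1}\Big(\operatorname{Dom}_{m-1}(\mathbf y)\setminus\bigcup_{\mathbf p\in P}\operatorname{Dom}_{m-1}(\mathbf p)\Big).$$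
   Context: Minimization is considered, with a fixed reference point $\mathbf r\in\mathbb R^m$. An approximation set is a finite collection of points of the objective space $\mathbb R^m$. For vectors of equal dimension, $\mathbf p\prec\mathbf q$ (''$\mathbf p$ dominates $\mathbf q$'') means $p_i<q_i$ for all $i$. The hypervolume indicator of a finite $Y\subset\mathbb R^m$ is $\operatorname{HV}(Y)=\lambda_m(\{\mathbf p\in\mathbb R^m: \exists \mathbf y\in Y,\ \mathbf y\prec\mathbf p\prec\mathbf r\})$, with $\lambda_m$ the $m$-dimensional Lebesgue measure. The map $\operatorname{concat}$ sends $(\mathbf y^{(1)},\dots,\mathbf y^{(n)})$ to $\mathbf Y=(y^{(1)}_1,\dots,y^{(1)}_m,\dots,y^{(n)}_1,\dots,y^{(n)}_m)^\top\in\mathbb R^{nm}$, and $\mathcal H:\mathbb R^{nm}\to\mathbb R_{\ge0}$ is $\mathcal H=\operatorname{HV}\circ\operatorname{concat}^{-1}$. The operator $\operatorname{proj}_k$ drops the $k$-th component of a vector. In $\mathbb R^{m-1}$ the hypervolume indicator is taken with reference point $\operatorname{proj}_k(\mathbf r)$, and $\operatorname{Dom}_{m-1}(\mathbf y)=\{\mathbf p\in\mathbb R^{m-1}:\mathbf y\prec\mathbf p\prec\operatorname{proj}_k(\mathbf r)\}$ is the space dominated by $\mathbf y$.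
   Formalization: Assumes y^(i)_k ≤ r_k; the derivative's existence is claimed only if y^(i)_k < r_k and points tied with y^(i) in component k cover nothing of its projected box beyond the strictly better points; otherwise only the left derivative, and the value whenever the derivative exists, are given. *)

(* Defs.v *)
From HB Require Import structures.
From mathcomp Require Import all_boot all_order all_algebra.
From mathcomp Require Import all_classical all_reals all_analysis.
Set Implicit Arguments.
Unset Strict Implicit.
Unset Printing Implicit Defensive.
Import Order.TTheory GRing.Theory Num.Theory.
Import numFieldNormedType.Exports.
Local Open Scope classical_set_scope.
Local Open Scope ring_scope.

Section lebesgue_tuple_measure.
Local Open Scope ereal_scope.
Variable R : realType.
Local Notation T := (measurableTypeR R).

Section cons_measure.
Variables (n : nat) (mu : {sigma_finite_measure set (n.-tuple T) -> \bar R}).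

Local Notation nu := (@lebesgue_measure R \x mu).

Let nu_sigma_finite : sigma_finite setT nu.
Proof.
have /sigma_finiteP[F [FT ndF Foo]] := sigma_finiteT (@lebesgue_measure R).
have /sigma_finiteP[G [GT ndG Goo]] := sigma_finiteT mu.
exists (fun k => F k `*` G k) => [|k].
  rewrite -setXTT FT GT; apply/seteqP; split=> [[x y] [[i _ Fx] [j _ Gy]]|].
    exists (maxn i j) => //; split => /=.
      by move: Fx; exact/subsetPset/ndF/leq_maxl.
    by move: Gy; exact/subsetPset/ndG/leq_maxr.
  by move=> [x y] [k _ [Fx Gy]]; split; exists k.
have [mF Fk] := Foo k; have [mG Gk] := Goo k; split; first exact: measurableX.
by rewrite product_measure1E// lte_mul_pinfty// ge0_fin_numE.
Qed.

Let cons_pair (x : T * n.-tuple T) : n.+1.-tuple T := [tuple of x.1 :: x.2].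

Let measurable_cons_pair : measurable_fun setT cons_pair.
Proof. exact: measurable_cons. Qed.

Let uncons (t : n.+1.-tuple T) : T * n.-tuple T :=
  (thead t, [tuple of behead t]).

Let measurable_uncons : measurable_fun setT uncons.
Proof.
apply/measurable_fun_pairP; split; last exact: measurable_behead.
exact: measurable_tnth.
Qed.

(* The image of lebesgue_measure \x mu under (t, x) |-> t :: x. *)
Definition cons_measure : set (n.+1.-tuple T) -> \bar R :=
  pushforward nu cons_pair.

Let cons_measure0 : cons_measure set0 = 0.
Proof. by rewrite /cons_measure /pushforward preimage_set0 measure0. Qed.

Let cons_measure_ge0 A : 0 <= cons_measure A.
Proof. exact: measure_ge0. Qed.

Let cons_measure_sigma_additive : semi_sigma_additive cons_measure.
Proof.
have mE A : measurable A -> measurable (cons_pair @^-1` A).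
  by move=> mA; rewrite -[X in measurable X]setTI; exact: measurable_cons_pair.
move=> F mF tF mUF; rewrite /cons_measure /pushforward preimage_bigcup.
apply: measure_semi_sigma_additive => [k||]; first exact: mE.
- apply/trivIsetP => i j _ _ ij; rewrite -preimage_setI.
  by move/trivIsetP : tF => -> //; rewrite preimage_set0.
- by rewrite -preimage_bigcup; exact: mE.
Qed.

HB.instance Definition _ := isMeasure.Build _ _ _ cons_measure
  cons_measure0 cons_measure_ge0 cons_measure_sigma_additive.

Let cons_measure_sigma_finite : sigma_finite setT cons_measure.
Proof.
have [F FT Foo] := nu_sigma_finite.
exists (fun k => uncons @^-1` F k) => [|k].
  by rewrite -preimage_bigcup -FT preimage_setT.
have [mF Fk] := Foo k; split.
  by rewrite -[X in measurable X]setTI; exact: measurable_uncons.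
rewrite /cons_measure /pushforward (_ : _ @^-1` _ = F k)//.
apply/funext => -[t x]; rewrite /preimage/= /uncons theadE.
by congr (F k (_, _)); exact/val_inj.
Qed.

HB.instance Definition _ := Measure_isSigmaFinite.Build _ _ _ cons_measure
  cons_measure_sigma_finite.

End cons_measure.

Fixpoint lebesgue_tuple n : {sigma_finite_measure set (n.-tuple T) -> \bar R} :=
  if n is n'.+1 then cons_measure (lebesgue_tuple n') else dirac [tuple].

End lebesgue_tuple_measure.

Section hypervolume.
Variable R : realType.

(* m-dimensional Lebesgue measure, carried from m-tuples to row vectors. *)
Definition lebesgue_rV m (A : set 'rV[R]_m) : \bar R :=
  lebesgue_tuple R m [set t | A (\row_j tnth t j)].

Definition dominates m (p q : 'rV[R]_m) : Prop := forall j, p 0 j < q 0 j.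

Definition Dom m (r y : 'rV[R]_m) : set 'rV[R]_m :=
  [set p | dominates y p /\ dominates p r].

Definition HV m (r : 'rV[R]_m) (P : set 'rV[R]_m) : R :=
  fine (lebesgue_rV
    [set p | exists2 y, P y & dominates y p /\ dominates p r]).

Definition HVC m (r y : 'rV[R]_m) (P : set 'rV[R]_m) : R :=
  HV r (P `|` [set y]) - HV r P.

(* mxvec lists the rows one after the other. *)
Definition concat n m (Y : 'I_n -> 'rV[R]_m) : 'rV[R]_(n * m) :=
  mxvec (\matrix_i Y i).

Definition concat_inv n m (V : 'rV[R]_(n * m)) : 'I_n -> 'rV[R]_m :=
  fun i => row i (vec_mx V).

Definition calH n m (r : 'rV[R]_m) (V : 'rV[R]_(n * m)) : R :=
  HV r (range (concat_inv V)).

(* The coordinate direction of y^(i)_k in R^(nm). *)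
Definition coord_dir n m (i : 'I_n) (k : 'I_m) : 'rV[R]_(n * m) :=
  delta_mx 0 (mxvec_index i k).

Definition proj_drop m (k : 'I_m) (y : 'rV[R]_m) : 'rV[R]_m.-1 := col' k y.

Definition better_idx n m (Y : 'I_n -> 'rV[R]_m) (i : 'I_n) (k : 'I_m) :
    set 'I_n :=
  [set a | Y a 0 k < Y i 0 k].

End hypervolume.

(* Main.v *)
Require Import Defs.
From HB Require Import structures.
From mathcomp Require Import all_boot all_order all_algebra.
From mathcomp Require Import all_classical all_reals all_analysis.
From mathcomp Require Import measurable_realfun.
Import Order.TTheory GRing.Theory Num.Theory.
Import numFieldNormedType.Exports.
Local Open Scope classical_set_scope.
Local Open Scope ring_scope.

(** Raising the [k]-th coordinate of one point [y^(i)] from [s] to [s'], while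
everything else stays put, removes from the dominated region exactly the points
[p] with [s < p_k <= s'] whose projection along [k] is dominated by the
projection of [y^(i)] and by no projection of another point that is already
active at height [p_k], i.e. whose [k]-th coordinate lies below [p_k]. As long
as the set [E] of projections covered by the active points does not depend on
the height within this layer (and the layer lies below the reference point),
the removed set is a product of an interval with [Dom \ E], so its measure is
[(s' - s)] times the measure of [Dom \ E] in one dimension less. This is
[HV_raise_coord]; it rests on the product formula [lebesgue_rV_slab].

For a small decrease of [y^(i)_k] no other point has its [k]-th coordinate
strictly inside the layer, and the active points are precisely those strictly
better than [y^(i)] in coordinate [k]. Hence the hypervolume is affine to the
left of the current value, with slope [- hvc] ([calH_left_increment]): the left
difference quotient is eventually constant. For a small increase the active
points also include those tied with [y^(i)] in coordinate [k]; when what ties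
share with the projected box of [y^(i)] is already covered by the strictly
better points, the same slope is obtained on the right
([calH_right_increment]) and the two one-sided limits give the derivative. When
the derivative is only known to exist, it must agree with the left limit. *)

(** * Slabs of tuples *)

Section tuple_slab.
Context {R : realType}.
Local Notation T := (measurableTypeR R).
Implicit Type n : nat.

Definition drop_tnth {S : Type} {n} (k : 'I_n.+1) (t : n.+1.-tuple S) : n.-tuple S :=
  [tuple tnth t (lift k j) | j < n].

Lemma drop_tnth0 {S : Type} {n} (x : S) (t : n.-tuple S) :
  drop_tnth ord0 [tuple of x :: t] = t.
Proof. by apply: eq_from_tnth => j; rewrite tnth_mktuple tnthS. Qed.

Lemma drop_tnth_lift {S : Type} {n} (k : 'I_n.+1) (x : S) (t : n.+1.-tuple S) :
  drop_tnth (lift ord0 k) [tuple of x :: t] = [tuple of x :: drop_tnth k t].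
Proof.
apply: eq_from_tnth => j; rewrite tnth_mktuple.
case: (unliftP ord0 j) => [j'|] ->.
  rewrite tnthS tnth_mktuple.
  have -> : lift (lift ord0 k) (lift ord0 j') = lift ord0 (lift k j').
    by apply/val_inj; rewrite /= /bump /= !add1n ltnS addnS.
  by rewrite tnthS.
have -> : lift (lift ord0 k) ord0 = ord0 by exact/val_inj.
by rewrite !tnth0.
Qed.

Lemma measurable_drop_tnth n (k : 'I_n.+1) :
  measurable_fun setT (drop_tnth k : n.+1.-tuple T -> n.-tuple T).
Proof.
apply/measurable_fun_tnthP => j.
rewrite (_ : _ \o _ = (fun t => tnth t (lift k j))); first exact: measurable_tnth.
by apply/funext => t /=; rewrite tnth_mktuple.
Qed.

Lemma measurable_slab n (k : 'I_n.+1) (J : set T) (B : set (n.-tuple T)) :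
  measurable J -> measurable B ->
  measurable [set t : n.+1.-tuple T | J (tnth t k) /\ B (drop_tnth k t)].
Proof.
move=> mJ mB; apply: measurableI.
  by rewrite -[X in measurable X]setTI; exact: measurable_tnth.
by rewrite -[X in measurable X]setTI; exact: measurable_drop_tnth.
Qed.

Let consT {n} (x : T) (t : n.-tuple T) : n.+1.-tuple T := [tuple of x :: t].

Lemma measurable_consl n (x : T) (B : set (n.+1.-tuple T)) :
  measurable B -> measurable [set t | B (consT x t)].
Proof.
by move=> mB; rewrite -[X in measurable X]setTI; apply: measurable_cons.
Qed.

(** Measurability of the sectional measure is what lets a constant factor be
pulled out of the iterated integral below. *)
Lemma measurable_section_measure n (B : set (n.+1.-tuple T)) :
  measurable B ->
  measurable_fun setT (fun x : T => lebesgue_tuple R n [set t | B (consT x t)]).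
Proof.
move=> mB.
have mC : measurable [set p : T * n.-tuple T | B (consT p.1 p.2)].
  by rewrite -[X in measurable X]setTI; apply: measurable_cons.
have := measurable_fun_xsection (lebesgue_tuple R n) mC.
congr measurable_fun; apply/funext => x/=.
by rewrite xsectionE.
Qed.

(** Tonelli's formula, the first coordinate being integrated last. *)
Lemma lebesgue_tupleS n (A : set (n.+1.-tuple T)) :
  (lebesgue_tuple R n.+1 A =
   \int[lebesgue_measure]_x lebesgue_tuple R n [set t | A (consT x t)])%E.
Proof.
transitivity ((lebesgue_measure \x lebesgue_tuple R n)%E
  [set p : T * n.-tuple T | A (consT p.1 p.2)]) => //.
by rewrite /product_measure1/=; under eq_integral do rewrite xsectionE.
Qed.

Lemma lebesgue_tuple_slab0 n (J : set T) (B : set (n.-tuple T)) :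
  measurable J -> measurable B ->
  (lebesgue_tuple R n.+1 [set t | J (tnth t ord0) /\ B (drop_tnth ord0 t)] =
   lebesgue_measure J * lebesgue_tuple R n B)%E.
Proof.
move=> mJ mB; rewrite -product_measure1E//.
transitivity ((lebesgue_measure \x lebesgue_tuple R n)%E
  [set p : T * n.-tuple T | J (tnth (consT p.1 p.2) ord0) /\
                            B (drop_tnth ord0 (consT p.1 p.2))]) => //.
congr (_ _); apply/funext => -[x t] /=.
by rewrite tnth0 drop_tnth0.
Qed.

(** The measure on tuples is built by adding a head coordinate, so for [k = 0]
this is the product formula itself. For [k = k' + 1], the section of the slab
at a head value [x] is again a slab, in the [k']-th coordinate and with base
the section of [B] at [x]; induction yields the factor
[lebesgue_measure J] in every section, and Tonelli reassembles the sections
of [B]. *)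
Lemma lebesgue_tuple_slab n (k : 'I_n.+1) (J : set T) (B : set (n.-tuple T)) :
  measurable J -> measurable B ->
  (lebesgue_tuple R n.+1 [set t | J (tnth t k) /\ B (drop_tnth k t)] =
   lebesgue_measure J * lebesgue_tuple R n B)%E.
Proof.
move=> mJ mB; elim: n k B mB => [|n IH] k B mB;
  case: (unliftP ord0 k) => [k'|] ->; first by case: k'.
- exact: lebesgue_tuple_slab0.
- rewrite lebesgue_tupleS.
  transitivity (\int[lebesgue_measure]_x (lebesgue_measure J *
      lebesgue_tuple R n [set t | B (consT x t)]))%E.
    apply: eq_integral => x _; rewrite -(IH k'); last exact: measurable_consl.
    congr (lebesgue_tuple _ _ _); apply/funext => t /=.
    by rewrite drop_tnth_lift tnthS.
  rewrite ge0_integralZl//; last exact: measurable_section_measure.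
  by rewrite -lebesgue_tupleS.
- exact: lebesgue_tuple_slab0.
Qed.
End tuple_slab.

(** * Lebesgue measure on row vectors *)

Section row_vectors.
Context {R : realType}.
Local Notation T := (measurableTypeR R).
Implicit Type m : nat.

(** Measurability is read on tuples because [lebesgue_rV] is the transport of a
measure on tuples. *)
Definition rV_measurable {m} (A : set 'rV[R]_m) : Prop :=
  measurable [set t : m.-tuple T | A (\row_j tnth t j)].

Lemma rV_measurableD m (A B : set 'rV[R]_m) :
  rV_measurable A -> rV_measurable B -> rV_measurable (A `\` B).
Proof. exact: measurableD. Qed.

Lemma rV_measurable_bigcup m {I : Type} (D : set I) (F : I -> set 'rV[R]_m) :
  finite_set D -> (forall i, D i -> rV_measurable (F i)) ->
  rV_measurable (\bigcup_(i in D) F i).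
Proof.
move=> Dfin mF.
exact: (@fin_bigcup_measurable _ _ _ D
  (fun i => [set t : m.-tuple T | F i (\row_j tnth t j)])).
Qed.

Lemma lebesgue_rVU m (A B : set 'rV[R]_m) :
  rV_measurable A -> rV_measurable B -> A `&` B = set0 ->
  (lebesgue_rV (A `|` B) = lebesgue_rV A + lebesgue_rV B)%E.
Proof.
move=> mA mB AB0; rewrite /lebesgue_rV -measureU//.
rewrite -subset0 => t ABt.
by have : (A `&` B) (\row_j tnth t j) by []; rewrite AB0.
Qed.

Lemma drop_tnth_row m (k : 'I_m.+1) (t : m.+1.-tuple R) :
  col' k (\row_j tnth t j) = \row_j tnth (drop_tnth k t) j.
Proof. by apply/rowP => j; rewrite !mxE tnth_mktuple. Qed.

Definition slab {m} (k : 'I_m.+1) (J : set R) (B : set 'rV[R]_m) :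
    set 'rV[R]_m.+1 :=
  [set p : 'rV[R]_m.+1 | J (p 0 k) /\ B (col' k p)].

Lemma slab_preimage m (k : 'I_m.+1) (J : set R) (B : set 'rV[R]_m) :
  [set t : m.+1.-tuple T | slab k J B (\row_j tnth t j)] =
  [set t | J (tnth t k) /\ [set t | B (\row_j tnth t j)] (drop_tnth k t)].
Proof. by apply/funext => t; rewrite /slab/= drop_tnth_row mxE. Qed.

Lemma rV_measurable_slab m (k : 'I_m.+1) (J : set R) (B : set 'rV[R]_m) :
  measurable J -> rV_measurable B ->
  rV_measurable (slab k J B).
Proof. by move=> mJ mB; rewrite /rV_measurable slab_preimage; apply: measurable_slab. Qed.

Lemma lebesgue_rV_slab m (k : 'I_m.+1) (J : set R) (B : set 'rV[R]_m) :
  measurable J -> rV_measurable B ->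
  (lebesgue_rV (slab k J B) =
   lebesgue_measure J * lebesgue_rV B)%E.
Proof. by move=> mJ mB; rewrite /lebesgue_rV slab_preimage lebesgue_tuple_slab. Qed.

(** * Dominated regions *)

(** Every box is a slab over the box of the projections; this reduces facts on
boxes to one dimension less, and exhibits the height [p 0 k] that the layer
argument moves along. *)
Lemma Dom_slab m (k : 'I_m.+1) (r y : 'rV[R]_m.+1) :
  Dom r y = slab k `]y 0 k, r 0 k[ (Dom (col' k r) (col' k y)).
Proof.
apply/funext => p; apply/propext; split; rewrite /slab/=.
  move=> [yp pr]; split; first by rewrite in_itv/= yp pr.
  by split=> j; rewrite !mxE.
rewrite in_itv/= => -[/andP[yp pr] [yp' pr']].
by split=> j; (case: (unliftP k j) => [j'|] ->//);
   [have := yp' j' | have := pr' j']; rewrite !mxE.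
Qed.

Lemma rV_measurable_Dom m (r y : 'rV[R]_m) : rV_measurable (Dom r y).
Proof.
elim: m r y => [|m IH] r y.
  rewrite /rV_measurable (_ : mkset _ = setT); first exact: measurableT.
  by apply/seteqP; split=> // t _; split=> -[].
by rewrite (Dom_slab _ ord0); apply: rV_measurable_slab => //; exact: measurable_itv.
Qed.

Lemma lebesgue_rV_Dom_fin m (r y : 'rV[R]_m) : (lebesgue_rV (Dom r y) < +oo)%E.
Proof.
elim: m r y => [|m IH] r y.
  by rewrite /lebesgue_rV/= diracE; case: (_ \in _); rewrite ltry.
rewrite (Dom_slab _ ord0) lebesgue_rV_slab;
  [|exact: measurable_itv|exact: rV_measurable_Dom].
apply: lte_mul_pinfty => //.
by rewrite lebesgue_measure_itv/=; case: ifP.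
Qed.

Definition dominated_region {m} (r : 'rV[R]_m) (P : set 'rV[R]_m) : set 'rV[R]_m :=
  \bigcup_(y in P) Dom r y.

Lemma rV_measurable_dominated_region m (r : 'rV[R]_m) (P : set 'rV[R]_m) :
  finite_set P -> rV_measurable (dominated_region r P).
Proof. by move=> Pfin; apply: rV_measurable_bigcup => // y _; exact: rV_measurable_Dom. Qed.

Lemma lebesgue_rV_dominated_region_fin m (r : 'rV[R]_m) (P : set 'rV[R]_m) :
  finite_set P -> lebesgue_rV (dominated_region r P) \is a fin_num.
Proof.
move=> Pfin; rewrite ge0_fin_numE; last exact: measure_ge0.
have := @content_sub_fsum _ _ _ (lebesgue_tuple R m) _ P
  [set t : m.-tuple T | dominated_region r P (\row_j tnth t j)]
  (fun y => [set t : m.-tuple T | Dom r y (\row_j tnth t j)]) Pfin.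
move=> /(_ (fun y _ => rV_measurable_Dom m r y)).
move=> /(_ (rV_measurable_dominated_region m r P Pfin) (@subset_refl _ _)).
move=> /le_lt_trans; apply.
rewrite fsbig_finite//=; apply: lte_sum_pinfty => y _.
exact: lebesgue_rV_Dom_fin.
Qed.

Lemma lebesgue_rV_DomD_fin m (r y : 'rV[R]_m) (E : set 'rV[R]_m) :
  rV_measurable E -> lebesgue_rV (Dom r y `\` E) \is a fin_num.
Proof.
move=> mE; rewrite ge0_fin_numE; last exact: measure_ge0.
apply: le_lt_trans (lebesgue_rV_Dom_fin m r y).
apply: le_measure; rewrite ?inE; [|exact: rV_measurable_Dom|by move=> ? []].
by apply: rV_measurableD => //; exact: rV_measurable_Dom.
Qed.

Lemma HVE m (r : 'rV[R]_m) (P : set 'rV[R]_m) :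
  HV r P = fine (lebesgue_rV (dominated_region r P)).
Proof. by []. Qed.

(** The contribution is a difference of two real numbers obtained through [fine];
it agrees with the measure of the difference because finitely many boxes have
finite total measure. *)
Lemma HVC_lebesgue m (r y : 'rV[R]_m) (P : set 'rV[R]_m) : finite_set P ->
  HVC r y P = fine (lebesgue_rV (Dom r y `\` dominated_region r P)).
Proof.
move=> Pfin; have mP := rV_measurable_dominated_region m r P Pfin.
rewrite /HVC !HVE (_ : dominated_region r (P `|` [set y]) =
    dominated_region r P `|` (Dom r y `\` dominated_region r P)); last first.
  by rewrite setUDr setDv setD0 /dominated_region bigcup_setU bigcup_set1.
rewrite lebesgue_rVU//; last 2 first.
- by apply: rV_measurableD => //; exact: rV_measurable_Dom.
- exact: setDIK.
rewrite fineD; first by rewrite addrAC subrr add0r.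
- exact: lebesgue_rV_dominated_region_fin.
- exact: lebesgue_rV_DomD_fin.
Qed.

(** * Moving one coordinate of one point *)

(** The region lost when the [k]-th coordinate of [Y i] is raised to that of
[Z i] is the slab over [Dom \ E] between the two heights. The hypothesis on [E]
says that the set covered by the other points active at height [t] is, within
the projected box of [Y i], the same for all [t] in the layer. *)
Lemma HV_raise_coord n m (r : 'rV[R]_m.+1) (Y Z : 'I_n -> 'rV[R]_m.+1)
    (i : 'I_n) (k : 'I_m.+1) (E : set 'rV[R]_m) :
  (forall a, a != i -> Z a = Y a) -> col' k (Z i) = col' k (Y i) ->
  Y i 0 k < Z i 0 k <= r 0 k -> rV_measurable E ->
  (forall t p, Y i 0 k < t <= Z i 0 k -> Dom (col' k r) (col' k (Y i)) p ->
     (exists a, [/\ a != i, Y a 0 k < t & Dom (col' k r) (col' k (Y a)) p]) <->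
     E p) ->
  HV r (range Y) = HV r (range Z) +
    (Z i 0 k - Y i 0 k) *
      fine (lebesgue_rV (Dom (col' k r) (col' k (Y i)) `\` E)).
Proof.
move=> ZY ZYi /andP[YZ Zr] mE EP.
set D := Dom _ _ `\` E.
have mD : rV_measurable D by apply: rV_measurableD => //; exact: rV_measurable_Dom.
(* The upper end of the layer belongs to the lost region exactly when it lies
   strictly below the reference point; hence an end that is open or closed
   according to this test. *)
pose J : set R := [set` Interval (BRight (Y i 0 k))
                                 (BSide (Z i 0 k == r 0 k) (Z i 0 k))].
have JP x : J x <-> [/\ Y i 0 k < x, x <= Z i 0 k & x < r 0 k].
  rewrite /J/= in_itv/=; case: eqP => [<-|/eqP Znr]/=.
    by split=> [/andP[? xZ]|[-> _ ->]//]; split=> //; exact: ltW.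
  split=> [/andP[? xZ]|[-> -> _]//]; split=> //.
  by rewrite (le_lt_trans xZ)// lt_neqAle Znr.
pose S := slab k J D.
have mS : rV_measurable S by apply: rV_measurable_slab => //; exact: measurable_itv.
have YZS : dominated_region r (range Y) = dominated_region r (range Z) `|` S.
  apply/seteqP; split=> p.
    case=> _ [a _ <-] Dp; have [ai|ai] := eqVneq a i; last first.
      by left; exists (Z a); [exists a|rewrite ZY].
    (* A point of the moving box stays dominated if it is above the new height,
       or if some other point covers it; otherwise it is in the slab. *)
    subst a; move: (Dp); rewrite (Dom_slab _ k) /slab/= in_itv/= => -[/andP[Yp pr] Dp'].
    have [Zp|pZ] := ltP (Z i 0 k) (p 0 k).
      by left; exists (Z i); [exists i|rewrite (Dom_slab _ k) /slab/= in_itv/= Zp pr ZYi].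
    have [Ep|nEp] := pselect (E (col' k p)); last first.
      by right; split=> //; exact/JP.
    have /(EP (p 0 k)) : E (col' k p) by [].
    rewrite Yp pZ => /(_ isT Dp')[b [bi Yb Dbp]].
    left; exists (Z b); first by exists b.
    by rewrite ZY// (Dom_slab _ k) /slab/= in_itv/= Yb pr.
  case=> [[_ [a _ <-] Dp]|[/JP[Yp pZ pr] [Dp _]]].
    exists (Y a); first by exists a.
    have [ai|ai] := eqVneq a i; last by rewrite -ZY.
    move: Dp; rewrite ai !(Dom_slab _ k) /slab/= !in_itv/= ZYi => -[/andP[Zp ->] ?].
    by rewrite (lt_trans YZ Zp).
  by exists (Y i); [exists i|rewrite (Dom_slab _ k) /slab/= in_itv/= Yp pr].
have ZS0 : dominated_region r (range Z) `&` S = set0.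
  rewrite -subset0 => p [[_ [a _ <-]]].
  rewrite (Dom_slab _ k) /slab/= in_itv/= => -[/andP[Zp pr] Dap] [/JP[Yp pZ _] [Dp]].
  apply; have [ai|ai] := eqVneq a i; first by move: Zp; rewrite ai ltNge pZ.
  apply/(EP (p 0 k)); rewrite ?Yp//; exists a; split=> //; by rewrite -ZY.
have finZ : finite_set (range Z) by exact: finite_image.
rewrite !HVE YZS lebesgue_rVU//; last exact: rV_measurable_dominated_region.
rewrite lebesgue_rV_slab//; last exact: measurable_itv.
rewrite lebesgue_measure_itv/= lte_fin YZ -EFinD fineD ?fineM//.
- exact: lebesgue_rV_DomD_fin.
- exact: lebesgue_rV_dominated_region_fin.
- by rewrite fin_numM//; exact: lebesgue_rV_DomD_fin.
Qed.


Definition shift_coord {n m} (Y : 'I_n -> 'rV[R]_m) (i : 'I_n) (k : 'I_m)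
    (h : R) : 'I_n -> 'rV[R]_m :=
  fun a => Y a + h *: row a (delta_mx i k).

Lemma shift_coord_neq n m (Y : 'I_n -> 'rV[R]_m) i k h a : a != i ->
  shift_coord Y i k h a = Y a.
Proof.
move=> ai; apply/rowP => j.
by rewrite !mxE (negbTE ai)/= mulr0 addr0.
Qed.

Lemma shift_coord_eq n m (Y : 'I_n -> 'rV[R]_m) i k h :
  shift_coord Y i k h i 0 k = Y i 0 k + h.
Proof. by rewrite !mxE !eqxx mulr1. Qed.

Lemma col'_shift_coord n m (Y : 'I_n -> 'rV[R]_m.+1) i k h a :
  col' k (shift_coord Y i k h a) = col' k (Y a).
Proof.
apply/rowP => j.
by rewrite !mxE [_ == k]eq_sym (negbTE (neq_lift _ _)) andbF mulr0 addr0.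
Qed.

Lemma calH_concat n m (r : 'rV[R]_m) (Y : 'I_n -> 'rV[R]_m) :
  calH r (concat Y) = HV r (range Y).
Proof.
rewrite /calH (_ : concat_inv (concat Y) = Y)//; apply/funext => a.
by rewrite /concat_inv /concat mxvecK rowK.
Qed.

Lemma calH_shift_coord n m (r : 'rV[R]_m) (Y : 'I_n -> 'rV[R]_m) i k h :
  calH r (h *: coord_dir R i k + concat Y) = HV r (range (shift_coord Y i k h)).
Proof.
rewrite -calH_concat; congr calH; rewrite /coord_dir -mxvec_delta /concat.
rewrite -linearZ -linearD/=; congr mxvec; apply/row_matrixP => a.
by rewrite rowK linearD linearZ/= rowK addrC.
Qed.

(** * One-sided increments of the hypervolume *)

Section one_sided.
Context {n m : nat} (r : 'rV[R]_m.+1) (Y : 'I_n -> 'rV[R]_m.+1).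
Context (i : 'I_n) (k : 'I_m.+1).

Let P := [set col' k (Y a) | a in better_idx Y i k].
Let hvc := HVC (col' k r) (col' k (Y i)) P.
Let dH h := calH r (h *: coord_dir R i k + concat Y) - calH r (concat Y).

Let Pfin : finite_set P. Proof. exact: finite_image. Qed.

(** Even when [Y i 0 k = r 0 k], the layer [Y_ik + h < t <= Y_ik] is below the
reference point up to a null set, so its full thickness counts. *)
Lemma calH_left_increment : Y i 0 k <= r 0 k ->
  \forall h \near 0^'-, dH h = h * - hvc.
Proof.
(* There are finitely many points, so for small [h] no strictly better one has
   its height in the layer. *)
move=> Yr; have near_better : \forall h \near 0^'-,
    forall a, Y a 0 k < Y i 0 k -> Y a 0 k < Y i 0 k + h.
  apply: (@filter_forall _ _ (fun a h => Y a 0 k < Y i 0 k ->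
      Y a 0 k < Y i 0 k + h)) => a; apply: filter_imply => YaYi.
  have : \forall h \near 0^'-, Y a 0 k - Y i 0 k < h.
    by apply: nbhs_left_gt; rewrite subr_lt0.
  by apply: filterS => h; rewrite ltrBlDl.
near=> h.
have h0 : h < 0 by near: h; exact: nbhs_left_lt.
have better_h : forall a, Y a 0 k < Y i 0 k -> Y a 0 k < Y i 0 k + h by near: h.
rewrite /dH calH_shift_coord calH_concat.
rewrite (HV_raise_coord n m r (shift_coord Y i k h) Y i k
  (dominated_region (col' k r) P)).
- rewrite col'_shift_coord -HVC_lebesgue// shift_coord_eq -/hvc.
  by rewrite opprD addrA subrr sub0r addrAC subrr add0r mulrN mulNr.
- by move=> a ai; rewrite shift_coord_neq.
- by rewrite col'_shift_coord.
- by rewrite shift_coord_eq gtrDl h0 Yr.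
- exact: rV_measurable_dominated_region.
move=> t p; rewrite shift_coord_eq => /andP[Yt tY] _; split.
  move=> [a []] ai; rewrite shift_coord_neq// => Yat Dap.
  exists (col' k (Y a)) => //; exists a => //.
  exact: lt_le_trans tY.
case=> _ [a YaYi <-] Dap; exists a.
have ai : a != i by apply: contraTneq YaYi => ->; rewrite /better_idx/= ltxx.
rewrite shift_coord_neq//; split => //.
exact: lt_trans (better_h a YaYi) Yt.
Unshelve. all: by end_near.
Qed.

(** Above the height [Y i 0 k] the points tied with [Y i] become active, so the
layer has base [Dom] minus the strictly better boxes only if the ties cover
nothing more of it. At [Y i 0 k = r 0 k] the box of [Y i] would be empty and
raising its coordinate would lose nothing. *)
Lemma calH_right_increment : Y i 0 k < r 0 k ->
  (forall a, a != i -> Y a 0 k = Y i 0 k ->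
     Dom (col' k r) (col' k (Y i)) `&` Dom (col' k r) (col' k (Y a))
     `<=` dominated_region (col' k r) P) ->
  \forall h \near 0^'+, dH h = h * - hvc.
Proof.
(* Likewise no strictly worse point becomes active within the layer. *)
move=> Yr ties; have near_worse : \forall h \near 0^'+,
    forall a, Y i 0 k < Y a 0 k -> Y i 0 k + h < Y a 0 k.
  apply: (@filter_forall _ _ (fun a h => Y i 0 k < Y a 0 k ->
      Y i 0 k + h < Y a 0 k)) => a; apply: filter_imply => YiYa.
  have : \forall h \near 0^'+, h < Y a 0 k - Y i 0 k.
    by apply: nbhs_right_lt; rewrite subr_gt0.
  by apply: filterS => h; rewrite ltrBrDl.
near=> h.
have h0 : 0 < h by near: h; exact: nbhs_right_gt.
have hr : h < r 0 k - Y i 0 k.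
  by near: h; apply: nbhs_right_lt; rewrite subr_gt0.
have worse_h : forall a, Y i 0 k < Y a 0 k -> Y i 0 k + h < Y a 0 k by near: h.
rewrite /dH calH_shift_coord calH_concat.
rewrite (HV_raise_coord n m r Y (shift_coord Y i k h) i k
  (dominated_region (col' k r) P)).
- rewrite -HVC_lebesgue// shift_coord_eq -/hvc.
  by rewrite [_ + h]addrC addrK opprD addrA subrr sub0r mulrN.
- by move=> a ai; rewrite shift_coord_neq.
- by rewrite col'_shift_coord.
- by rewrite shift_coord_eq ltrDl h0/= -lerBrDl ltW.
- exact: rV_measurable_dominated_region.
move=> t p; rewrite shift_coord_eq => /andP[Yt tY] Dip; split.
  move=> [a [ai Yat Dap]].
  have [YaYi|YiYa|YaYi] := ltgtP (Y a 0 k) (Y i 0 k).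
  - by exists (col' k (Y a)) => //; exists a.
  - by have := lt_le_trans Yat tY; rewrite ltNge ltW// worse_h.
  - exact: (ties a).
case=> _ [a YaYi <-] Dap; exists a.
have ai : a != i by apply: contraTneq YaYi => ->; rewrite /better_idx/= ltxx.
by split => //; exact: lt_trans YaYi Yt.
Unshelve. all: by end_near.
Qed.

End one_sided.
End row_vectors.

Theorem theorem4 (R : realType) (m n : nat) (hm : (2 <= m)%N) (hn : (1 <= n)%N)
    (r : 'rV[R]_m) (Y : 'I_n -> 'rV[R]_m) (i : 'I_n) (k : 'I_m) :
  let P := [set proj_drop k (Y a) | a in better_idx Y i k] in
  let hvc := HVC (proj_drop k r) (proj_drop k (Y i)) P in
  let H := calH (n := n) r in
  let YY := concat Y in
  let e := coord_dir R i k in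
  hvc = fine (lebesgue_rV (Dom (proj_drop k r) (proj_drop k (Y i))
                `\` \bigcup_(p in P) Dom (proj_drop k r) p)) /\
  (Y i 0 k <= r 0 k ->
   [/\ (Y i 0 k < r 0 k -> (forall a, a != i -> Y a 0 k = Y i 0 k ->
          Dom (proj_drop k r) (proj_drop k (Y i))
            `&` Dom (proj_drop k r) (proj_drop k (Y a))
          `<=` \bigcup_(p in P) Dom (proj_drop k r) p) ->
        is_derive YY e H (- hvc)),
       (derivable H YY e -> 'D_e H YY = - hvc)
     & (fun h : R => h^-1 *: (H (h *: e + YY) - H YY)) @ 0^'- --> - hvc]).
Proof.
move=> P hvc H YY e; split.
  by apply: HVC_lebesgue; exact: finite_image.
case: m hm r Y k @P @hvc @H @YY @e => [//|m] hm r Y k P hvc H YY e Yr.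
have quotient_cvg (F : set_system R) : Filter F ->
    (\forall h \near F, h != 0) ->
    (\forall h \near F, H (h *: e + YY) - H YY = h * - hvc) ->
    (fun h : R => h^-1 *: (H (h *: e + YY) - H YY)) @ F --> - hvc.
  move=> FF F0 FH; apply: cvg_near_cst; near=> h.
  have -> : H (h *: e + YY) - H YY = h * - hvc by near: h.
  by rewrite -[_ *: _]/(_ * _) mulKf//; near: h.
have left_cvg : (fun h : R => h^-1 *: (H (h *: e + YY) - H YY)) @ 0^'- --> - hvc.
  apply: quotient_cvg; last exact: calH_left_increment.
  by near=> h; rewrite lt_eqF//; near: h; exact: nbhs_left_lt.
split=> // [Yr' ties|dH].
  have dH : (fun h : R => h^-1 *: (H (h *: e + YY) - H YY)) @ 0^' --> - hvc.
    apply: (@cvg_at_right_left_dnbhs R R^o) => //.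
    apply: quotient_cvg; last exact: calH_right_increment.
    by near=> h; rewrite gt_eqF//; near: h; exact: nbhs_right_gt.
  apply: DeriveDef; first by apply/cvg_ex; exists (- hvc).
  exact: cvg_lim dH.
rewrite /derive cvg_at_leftE//; exact: cvg_lim left_cvg.
Unshelve. all: by end_near.
Qed.
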